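(* Let $a,b,p,q$ be real numbers with $p^2+4q\neq 0$, let $Q_{w,n}$ ($n\ge 0$) be the Horadam quaternions with parameters $(a,b;p,q)$, and let $\alpha=\frac{p+\sqrt{p^2+4q}}{2}$, $\beta=\frac{p-\sqrt{p^2+4q}}{2}$, $A=b-a\beta$, $B=b-a\alpha$, $\underline{\alpha}=1+i\alpha+j\alpha^2+k\alpha^3$, $\underline{\beta}=1+i\beta+j\beta^2+k\beta^3$. Then for every integer $n\ge 1$, $$Q_{w,n-1}Q_{w,n+1}-Q_{w,n}^2=\frac{AB\,\alpha^{n-1}\beta^{n-1}}{\alpha-\beta}\left(\beta\,\underline{\alpha}\,\underline{\beta}-\alpha\,\underline{\beta}\,\underline{\alpha}\right).$$
   Context: The Horadam sequence $W_n=W_n(a,b;p,q)$ is defined by $W_0=a$, $W_1=b$ and $W_n=pW_{n-1}+qW_{n-2}$ for $n\ge 2$. The Horadam quaternions are $Q_{w,n}=W_n+W_{n+1}i+W_{n+2}j+W_{n+3}k$ for $n\ge 0$, where $i,j,k$ are the Hamilton units with $i^2=j^2=k^2=ijk=-1$. When $p^2+4q<0$ the numbers $\alpha,\beta$ are complex scalars and the identity is read in the complexified quaternion algebra $\mathbb{H}\otimes_{\mathbb{R}}\mathbb{C}$, where complex scalars are central (a square root of $p^2+4q$ in $\mathbb{C}$ being fixed). Convention: $x^0=1$ for every $x$, including $x=0$. *)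

(* Defs.v *)
From HB Require Import structures.
From mathcomp Require Import all_boot all_order all_algebra.
From mathcomp Require Import ring.
From mathcomp Require Import reals.
From mathcomp.real_closed Require Export complex.

Set Implicit Arguments.
Unset Strict Implicit.
Unset Printing Implicit Defensive.

Import Order.TTheory GRing.Theory Num.Theory.
Local Open Scope ring_scope.

(* [Quat x y z t] is x + y i + z j + t k.  For a commutative ring F, [quat F]
   is the Hamilton quaternion algebra over F: [quat R] is H for R real, and
   [quat R[i]] is H (x)_R C, in which the scalars R[i] are central and the
   imaginary unit of R[i] is unrelated to the quaternion unit [qi]. *)
Record quat (F : Type) : Type :=
  Quat { qre : F; qim_i : F; qim_j : F; qim_k : F }.

Definition prod_of_quat (F : Type) (x : quat F) : F * F * F * F :=
  let: Quat x0 x1 x2 x3 := x in (x0, x1, x2, x3).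

Definition quat_of_prod (F : Type) (x : F * F * F * F) : quat F :=
  let: (x0, x1, x2, x3) := x in Quat x0 x1 x2 x3.

Lemma prod_of_quatK (F : Type) : cancel (@prod_of_quat F) (@quat_of_prod F).
Proof. by case. Qed.

HB.instance Definition _ (F : choiceType) :=
  Choice.copy (quat F) (can_type (@prod_of_quatK F)).

Section QuatAlgebra.
Variable F : comNzRingType.
Implicit Types x y z : quat F.

Definition addq x y : quat F :=
  Quat (qre x + qre y) (qim_i x + qim_i y)
       (qim_j x + qim_j y) (qim_k x + qim_k y).

Definition oppq x : quat F :=
  Quat (- qre x) (- qim_i x) (- qim_j x) (- qim_k x).

Fact addqA : associative addq.
Proof. by move=> [????] [????] [????]; congr Quat => /=; ring. Qed.
Fact addqC : commutative addq.
Proof. by move=> [????] [????]; congr Quat => /=; ring. Qed.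
Fact add0q : left_id (Quat 0 0 0 0) addq.
Proof. by move=> [????]; congr Quat => /=; ring. Qed.
Fact addNq : left_inverse (Quat 0 0 0 0) oppq addq.
Proof. by move=> [????]; congr Quat => /=; ring. Qed.

HB.instance Definition _ :=
  GRing.isZmodule.Build (quat F) addqA addqC add0q addNq.

Definition mulq x y : quat F :=
  let: Quat x0 x1 x2 x3 := x in
  let: Quat y0 y1 y2 y3 := y in
  Quat (x0 * y0 - x1 * y1 - x2 * y2 - x3 * y3)
       (x0 * y1 + x1 * y0 + x2 * y3 - x3 * y2)
       (x0 * y2 - x1 * y3 + x2 * y0 + x3 * y1)
       (x0 * y3 + x1 * y2 - x2 * y1 + x3 * y0).

Fact mulqA : associative mulq.
Proof. by move=> [????] [????] [????]; congr Quat => /=; ring. Qed.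
Fact mul1q : left_id (Quat 1 0 0 0) mulq.
Proof. by move=> [????]; congr Quat => /=; ring. Qed.
Fact mulq1 : right_id (Quat 1 0 0 0) mulq.
Proof. by move=> [????]; congr Quat => /=; ring. Qed.
Fact mulqDl : left_distributive mulq addq.
Proof. by move=> [????] [????] [????]; congr Quat => /=; ring. Qed.
Fact mulqDr : right_distributive mulq addq.
Proof. by move=> [????] [????] [????]; congr Quat => /=; ring. Qed.
Fact oneq_neq0 : Quat 1 0 0 0 != 0 :> quat F.
Proof. by apply/eqP => -[] /eqP; rewrite oner_eq0. Qed.

HB.instance Definition _ :=
  GRing.Zmodule_isNzRing.Build (quat F) mulqA mul1q mulq1 mulqDl mulqDr oneq_neq0.

Definition scaleq (c : F) x : quat F :=
  Quat (c * qre x) (c * qim_i x) (c * qim_j x) (c * qim_k x).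

Fact scaleqA a b x : scaleq a (scaleq b x) = scaleq (a * b) x.
Proof. by congr Quat => /=; ring. Qed.
Fact scale1q : left_id 1 scaleq.
Proof. by move=> [????]; congr Quat => /=; ring. Qed.
Fact scaleqDr : right_distributive scaleq +%R.
Proof. by move=> c [????] [????]; congr Quat => /=; ring. Qed.
Fact scaleqDl x : {morph scaleq^~ x : a b / a + b}.
Proof. by move=> a b; congr Quat => /=; ring. Qed.

HB.instance Definition _ :=
  GRing.Zmodule_isLmodule.Build F (quat F) scaleqA scale1q scaleqDr scaleqDl.

Fact scaleqAl c x y : c *: (x * y) = (c *: x) * y.
Proof. by case: x y => [????] [????]; congr Quat => /=; ring. Qed.
HB.instance Definition _ := GRing.Lmodule_isLalgebra.Build F (quat F) scaleqAl.

Fact scaleqAr c x y : c *: (x * y) = x * (c *: y).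
Proof. by case: x y => [????] [????]; congr Quat => /=; ring. Qed.
HB.instance Definition _ := GRing.Lalgebra_isAlgebra.Build F (quat F) scaleqAr.

Definition qi : quat F := Quat 0 1 0 0.
Definition qj : quat F := Quat 0 0 1 0.
Definition qk : quat F := Quat 0 0 0 1.

Lemma quat_units :
  [/\ qi * qi = -1, qj * qj = -1, qk * qk = -1 & qi * qj * qk = -1].
Proof. by split; congr Quat => /=; ring. Qed.

Lemma quatE (x0 x1 x2 x3 : F) :
  Quat x0 x1 x2 x3 = x0%:A + x1 *: qi + x2 *: qj + x3 *: qk.
Proof. by congr Quat => /=; ring. Qed.

End QuatAlgebra.

Definition map_quat (F G : Type) (f : F -> G) (x : quat F) : quat G :=
  Quat (f (qre x)) (f (qim_i x)) (f (qim_j x)) (f (qim_k x)).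

Section MapQuat.
Variables (F G : comNzRingType) (f : {rmorphism F -> G}).

Fact map_quat_is_zmod_morphism : zmod_morphism (map_quat f).
Proof. by move=> [????] [????]; congr Quat => /=; rewrite rmorphB. Qed.
HB.instance Definition _ :=
  GRing.isZmodMorphism.Build (quat F) (quat G) (map_quat f)
    map_quat_is_zmod_morphism.

Fact map_quat_is_monoid_morphism : monoid_morphism (map_quat f).
Proof.
split; first by congr Quat => /=; rewrite ?rmorph1 ?rmorph0.
by move=> [????] [????]; congr Quat => /=; rewrite !(rmorphD, rmorphN, rmorphM).
Qed.
HB.instance Definition _ :=
  GRing.isMonoidMorphism.Build (quat F) (quat G) (map_quat f)
    map_quat_is_monoid_morphism.

End MapQuat.

Fixpoint horadam (F : pzRingType) (a b p q : F) (n : nat) : F :=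
  match n with
  | 0 => a
  | m.+1 => match m with
            | 0 => b
            | l.+1 => p * horadam a b p q m + q * horadam a b p q l
            end
  end.

Definition horadam_quat (F : comNzRingType) (a b p q : F) (n : nat) : quat F :=
  let W := horadam a b p q in
  (W n)%:A + W n.+1 *: qi F + W n.+2 *: qj F + W n.+3 *: qk F.

(* 1 + i x + j x^2 + k x^3 *)
Definition underq (F : comNzRingType) (x : F) : quat F :=
  1 + x *: qi F + x ^+ 2 *: qj F + x ^+ 3 *: qk F.

(* Main.v *)
(* Write u = underq alpha and v = underq beta.  Binet's formula
   (alpha - beta) Q_n = A alpha^n u - B beta^n v turns
   (alpha - beta)^2 (Q_(n-1) Q_(n+1) - Q_n^2) into an expression in which the
   u^2 and v^2 terms cancel, and the uv and vu terms carry one factor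
   alpha - beta each. *)
Require Import Defs.
From mathcomp Require Import all_boot all_order all_algebra reals.
From mathcomp Require Import ring.
From mathcomp.real_closed Require Import complex.

Import GRing.Theory Num.Theory.
Local Open Scope ring_scope.
Local Open Scope complex_scope.

Section Horadam.
Variables (F : comNzRingType) (a b alpha beta : F).
(** By Vieta, [alpha] and [beta] are the roots of X^2 - p X - q; taking them as parameters avoids
    square roots. *)
Let p := alpha + beta.
Let q := - (alpha * beta).
Let A := b - a * beta.
Let B := b - a * alpha.

Lemma horadam_binet (n : nat) :
  (alpha - beta) * horadam a b p q n = A * alpha ^+ n - B * beta ^+ n.
Proof.
(* The recurrence has order two, so the induction carries two consecutive indices. *)
suff [] : (alpha - beta) * horadam a b p q n = A * alpha ^+ n - B * beta ^+ n
  /\ (alpha - beta) * horadam a b p q n.+1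
     = A * alpha ^+ n.+1 - B * beta ^+ n.+1 by [].
elim: n => [|n [IH0 IH1]].
  by rewrite /A /B !expr0 !expr1 /=; split; ring.
split=> //.
have -> : horadam a b p q n.+2
    = p * horadam a b p q n.+1 + q * horadam a b p q n by [].
rewrite mulrDr mulrCA IH1 [X in _ + X]mulrCA IH0 /p /q !exprS; ring.
Qed.

Lemma horadam_quat_binet (n : nat) :
  (alpha - beta) *: horadam_quat a b p q n
  = (A * alpha ^+ n) *: underq alpha - (B * beta ^+ n) *: underq beta.
Proof.
(* The leading [1] of each [underq] becomes [1%:A], so that [quatE] folds every sum into [Quat] and
   the claim splits into components. *)
rewrite /horadam_quat /underq -[X in X + alpha *: _]scale1r.
rewrite -[X in _ - _ *: (X + _ + _ + _)]scale1r -!quatE.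
by congr Quat; rewrite horadam_binet ?exprS /=; ring.
Qed.

(** With denominators cleared, this holds over any commutative ring. Here [n] stands for the n - 1
    of the theorem. *)
Lemma horadam_quat_cassini_scaled (n : nat) :
  (alpha - beta) ^+ 2 *:
    (horadam_quat a b p q n * horadam_quat a b p q n.+2
     - horadam_quat a b p q n.+1 ^+ 2)
  = ((alpha - beta) * (A * B * alpha ^+ n * beta ^+ n)) *:
      (beta *: (underq alpha * underq beta)
       - alpha *: (underq beta * underq alpha)).
Proof.
have scaleM x (y z : quat F) : x ^+ 2 *: (y * z) = (x *: y) * (x *: z).
  by rewrite -scalerAl -scalerAr scalerA.
rewrite expr2 scalerBr !scaleM !horadam_quat_binet !exprS.
(* After Binet the identity holds for arbitrary quaternions in place of [underq alpha] and
   [underq beta]. *)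
move: (underq alpha) (underq beta) => [u0 u1 u2 u3] [v0 v1 v2 v3].
by congr Quat => /=; ring.
Qed.

End Horadam.

Lemma horadam_quat_cassini (F : fieldType) (a b p q alpha beta : F) (n : nat) :
  alpha != beta -> p = alpha + beta -> q = - (alpha * beta) ->
  horadam_quat a b p q n * horadam_quat a b p q n.+2
    - horadam_quat a b p q n.+1 ^+ 2
  = ((b - a * beta) * (b - a * alpha) * alpha ^+ n * beta ^+ n
       / (alpha - beta)) *:
      (beta *: (underq alpha * underq beta)
       - alpha *: (underq beta * underq alpha)).
Proof.
rewrite -subr_eq0 => d_neq0 -> ->.
have d2_neq0 : (alpha - beta) ^+ 2 != 0 by rewrite expf_neq0.
apply: (scalerI d2_neq0); rewrite horadam_quat_cassini_scaled scalerA.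
by congr (_ *: _); field.
Qed.

Lemma map_horadam (F G : comNzRingType) (f : {rmorphism F -> G})
    (a b p q : F) (n : nat) :
  f (horadam a b p q n) = horadam (f a) (f b) (f p) (f q) n.
Proof.
suff [] : f (horadam a b p q n) = horadam (f a) (f b) (f p) (f q) n
  /\ f (horadam a b p q n.+1) = horadam (f a) (f b) (f p) (f q) n.+1 by [].
elim: n => // n [IH0 IH1]; split=> //.
by rewrite [LHS](rmorphD f (p * _)) !rmorphM IH0 IH1.
Qed.

Lemma map_horadam_quat (F G : comNzRingType) (f : {rmorphism F -> G})
    (a b p q : F) (n : nat) :
  map_quat f (horadam_quat a b p q n)
  = horadam_quat (f a) (f b) (f p) (f q) n.
Proof. by rewrite /horadam_quat -!quatE -!map_horadam. Qed.

(** The two roots differ by [s], hence are distinct, and their product is (p^2 - s^2) / 4 = -q. *)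
Lemma half_sum_roots (F : fieldType) (p q s : F) :
  2 != 0 :> F -> s ^+ 2 = p ^+ 2 + 4 * q -> s != 0 ->
  [/\ (p + s) / 2 != (p - s) / 2, p = (p + s) / 2 + (p - s) / 2
    & q = - ((p + s) / 2 * ((p - s) / 2))].
Proof.
move=> two_neq0 s2 s_neq0; split; last 2 first.
- by field.
- have -> : - ((p + s) / 2 * ((p - s) / 2)) = (s ^+ 2 - p ^+ 2) / 4.
    by field; rewrite (natrM F 2 2) mulf_neq0.
  by rewrite s2; field; rewrite (natrM F 2 2) mulf_neq0.
by rewrite -subr_eq0; have -> : (p + s) / 2 - (p - s) / 2 = s by field.
Qed.

(* The first conjunct is the identity in H, with the real square root; the
   second is the identity in the complexification of H, for each choice of the
   complex square root s of p^2 + 4q. *)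
Theorem theorem3p5 (R : realType) (a b p q : R) (n : nat) :
  p ^+ 2 + 4 * q != 0 -> (1 <= n)%N ->
  (0 < p ^+ 2 + 4 * q ->
     let s := Num.sqrt (p ^+ 2 + 4 * q) in
     let alpha := (p + s) / 2 in
     let beta := (p - s) / 2 in
     let A := b - a * beta in
     let B := b - a * alpha in
     let Q := horadam_quat a b p q in
     Q (n - 1)%N * Q (n + 1)%N - Q n ^+ 2 =
       (A * B * alpha ^+ (n - 1) * beta ^+ (n - 1) / (alpha - beta)) *:
         (beta *: (underq alpha * underq beta)
          - alpha *: (underq beta * underq alpha)))
  /\
  (forall s : R[i], s ^+ 2 = (p ^+ 2 + 4 * q)%:C ->
     let alpha := (p%:C + s) / 2 in
     let beta := (p%:C - s) / 2 in
     let A := b%:C - a%:C * beta in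
     let B := b%:C - a%:C * alpha in
     let Q := fun m => map_quat (real_complex R) (horadam_quat a b p q m) in
     Q (n - 1)%N * Q (n + 1)%N - Q n ^+ 2 =
       (A * B * alpha ^+ (n - 1) * beta ^+ (n - 1) / (alpha - beta)) *:
         (beta *: (underq alpha * underq beta)
          - alpha *: (underq beta * underq alpha))).
Proof.
(* Passing to [n.+1] makes the truncated subtraction [n - 1] exact. *)
case: n => [|n] // disc_neq0 _; rewrite subSS subn0 addn1; split.
  move=> disc_gt0 s alpha beta A B Q.
  have s2 : s ^+ 2 = p ^+ 2 + 4 * q by rewrite sqr_sqrtr // Order.POrderTheory.ltW.
  have s_neq0 : s != 0 by rewrite -sqrf_eq0 s2.
  have two_neq0 : 2 != 0 :> R by rewrite pnatr_eq0.
  have [ab_neq pE qE] := half_sum_roots _ _ _ _ two_neq0 s2 s_neq0.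
  exact: horadam_quat_cassini.
move=> s s2 alpha beta A B Q.
have s_neq0 : s != 0 by rewrite -sqrf_eq0 s2 fmorph_eq0.
(* The discriminant is now expressed in [p%:C] and [q%:C], as [half_sum_roots] requires. *)
rewrite rmorphD rmorphXn rmorphM rmorph_nat in s2.
have two_neq0 : 2 != 0 :> R[i] by rewrite pnatr_eq0.
have [ab_neq pE qE] := half_sum_roots _ _ _ _ two_neq0 s2 s_neq0.
(* The embedded real quaternions are the Horadam quaternions of the embedded parameters, so the
   identity over the field [R[i]] applies. *)
by rewrite /Q !map_horadam_quat; exact: horadam_quat_cassini.
Qed.
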